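(* Let $X_1,\dots,X_n$ be a random (i.i.d.) sample from a univariate distribution with a probability density function $f$ having support on $\mathbb R_+=[0,\infty)$. Suppose that $f$ is unbounded at $x=0$, i.e. $f(x)\to\infty$ as $x\downarrow0$, and that the smoothing parameter $b=b_n>0$ satisfies $b+(nb^2)^{-1}\to0$ as $n\to\infty$. Then $\hat f_-(0)\overset{p}{\longrightarrow}\infty$ as $n\to\infty$.
   Context: $c>0$ is a fixed point. For $a,z>0$, $\gamma(a,z)=\int_0^zt^{a-1}e^{-t}dt$. For $x\ge0$, $b>0$ the lower truncated gamma kernel is $$K^-_{G(x,b;c)}(u)=\frac{u^{x/b}e^{-u/b}}{b^{x/b+1}\gamma(x/b+1,c/b)}\mathbf 1(0\le u<c)$$ (with $u^0=1$), and $\hat f_-(x)=\frac1n\sum_{i=1}^nK^-_{G(x,b;c)}(X_i)$. Convergence in probability to $\infty$ means $\Pr(\hat f_-(0)>M)\to1$ for every $M>0$. *)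

(* Defs.v *)
From HB Require Import structures.
From mathcomp Require Import all_boot all_order all_algebra finmap.
From mathcomp Require Import all_classical all_reals all_analysis.

Set Implicit Arguments.
Unset Strict Implicit.
Unset Printing Implicit Defensive.

Import Order.TTheory GRing.Theory Num.Theory.
Import numFieldNormedType.Exports.

Local Open Scope classical_set_scope.
Local Open Scope ring_scope.

(** The function [gamma(a, z)], integral of [t^(a-1) e^(-t)] over [(0, z)],
    meant for [a, z > 0]. *)
Definition lower_incomplete_gamma (R : realType) (a z : R) : R :=
  \int[@lebesgue_measure R]_(t in `]0, z[%classic) (t `^ (a - 1) * expR (- t)).

(** The kernel [K^-_{G(x, b; c)}(u)].  The convention [u^0 = 1], also at
    [u = 0], is the one built into [powR]: [0 `^ 0 = 1]. *)
Definition truncated_gamma_kernel (R : realType) (c b x u : R) : R :=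
  u `^ (x / b) * expR (- (u / b))
    / (b `^ (x / b + 1) * lower_incomplete_gamma (x / b + 1) (c / b))
  * \1_(`[0, c[%classic) u.

(** The observations of a sample of size [n] are [s 0, ..., s (n - 1)]. *)
Definition density_estimator (R : realType) (c b : R) (n : nat) (s : nat -> R)
    (x : R) : R :=
  n%:R^-1 * \sum_(i < n) truncated_gamma_kernel c b x (s i).

Definition is_pdf (R : realType) (f : R -> R) : Prop :=
  [/\ measurable_fun setT f, (forall x, 0 <= f x)
    & (\int[@lebesgue_measure R]_x (f x)%:E = 1)%E].

Definition has_pdf (d : measure_display) (T : measurableType d) (R : realType)
    (P : probability T R) (X : {RV P >-> R}) (f : R -> R) : Prop :=
  forall A : set R, measurable A ->
    (distribution P X A = \int[@lebesgue_measure R]_(x in A) (f x)%:E)%E.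

Definition mutually_independent (d : measure_display) (T : measurableType d)
    (R : realType) (P : probability T R) (I : choiceType)
    (X : I -> {RV P >-> R}) : Prop :=
  forall (J : {fset I}) (A : I -> set R), (forall i, measurable (A i)) ->
    (P (\bigcap_(i in [set` J]) (X i @^-1` A i))
     = \prod_(i <- J) P (X i @^-1` A i))%E.

Definition iid_with_pdf (d : measure_display) (T : measurableType d)
    (R : realType) (P : probability T R) (X : nat -> {RV P >-> R})
    (f : R -> R) : Prop :=
  mutually_independent X /\ forall i, has_pdf (X i) f.

Definition cvg_in_probability_pinfty (d : measure_display)
    (T : measurableType d) (R : realType) (P : probability T R)
    (Y : nat -> T -> R) : Prop :=
  forall M : R, 0 < M -> P [set w | M < Y n w] @[n --> \oo] --> 1%E.

(* Main.v *)
(* At x = 0 the kernel is the exponential density truncated to [0, c), and it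
   dominates e^(-1) / b on [0, b) as soon as b <= c.  Hence
   f_hat(0) >= e^(-1) N / (n b), where N counts the observations in [0, b).
   Each of them falls there with probability p >= L b, for any L once b is
   small, because f blows up at 0.  By Chebyshev, N > n p / 2, so that
   f_hat(0) > e^(-1) L / 2, except with probability at most
   4 / (n p) <= 4 / (n L b), which tends to 0. *)

Require Import Defs.
From HB Require Import structures.
From mathcomp Require Import all_boot all_order all_algebra finmap.
From mathcomp Require Import all_classical all_reals all_analysis.
From mathcomp Require Import measurable_realfun.
From mathcomp Require Import ring lra.

Import Order.TTheory GRing.Theory Num.Theory.
Import numFieldNormedType.Exports.

Local Open Scope classical_set_scope.
Local Open Scope ring_scope.

(** * Counting pairwise independent, equiprobable events: moments and lower tail *)

Section event_counting.
Set Implicit Arguments.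
Unset Strict Implicit.
Context {R : realType} {d : measure_display} {T : measurableType d}.
Variable P : probability T R.

Lemma Lfun_indic (A : set T) (r : R) : measurable A -> 0 < r ->
  \1_A \in Lfun P r%:E.
Proof.
move=> mA r0; rewrite inE/=; apply/andP; split; rewrite inE//=.
rewrite /finite_norm unlock poweR_lty//.
apply: (@le_lt_trans _ _ (\int[P]_x (cst 1%E x))%E); last first.
  by rewrite integral_cst// mul1e (le_lt_trans (probability_le1 P measurableT)) ?ltry.
apply: ge0_le_integral => //=.
- apply/measurable_EFinP/(@measurableT_comp _ _ _ _ _ _ (fun x : R => x `^ r)) => //.
  exact/measurableT_comp.
- move=> x _; rewrite lee_fin indicE; case: (_ \in _) => /=.
    by rewrite normr1 powR1.
  by rewrite normr0 powR0// gt_eqF.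
Qed.

Lemma covariance_indic (A B : set T) : measurable A -> measurable B ->
  (covariance P \1_A \1_B = P (A `&` B) - P A * P B)%E.
Proof.
move=> mA mB.
rewrite covarianceE ?Lfun_indic//; last first.
  by apply: Lfun2_mul_Lfun1; rewrite Lfun_indic.
rewrite !expectation_indic//; congr (_ - _)%E.
by rewrite -(expectation_indic P (measurableI _ _ mA mB)) indicI.
Qed.

(** A sum of functions rather than a function of sums, so that expectation and covariance can be
    expanded one summand at a time. *)
Definition event_count (A : nat -> set T) (n : nat) : T -> R :=
  \sum_(i < n) \1_(A i).

Variable A : nat -> set T.
Hypothesis mA : forall i, measurable (A i).
Variable p : R.
Hypothesis PA : forall i, P (A i) = p%:E.
Hypothesis PAI : forall i j, i != j -> P (A i `&` A j) = (p ^+ 2)%:E.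

Lemma event_countS n :
  event_count A n.+1 = event_count A n \+ \1_(A n).
Proof. by rewrite /event_count big_ord_recr. Qed.

Lemma Lfun_event_count n : event_count A n \in Lfun P 2%:E.
Proof.
elim: n => [|n IH].
  rewrite /event_count big_ord0; exact: Lfun_cst.
rewrite event_countS; apply: (@rpredD) => [|?|?]; last exact: Lfun_indic.
  by rewrite lee_fin ler1n.
exact: IH.
Qed.

Lemma measurable_event_count n : measurable_fun setT (event_count A n).
Proof.
by have := sub_Lfun_mfun (Lfun_event_count n); rewrite inE.
Qed.

Lemma expectation_event_count n : ('E_P[event_count A n] = (n%:R * p)%:E)%E.
Proof.
have Pfin : P setT \is a fin_num := fin_num_measure P _ measurableT.
elim: n => [|n IH].
  by rewrite /event_count big_ord0 mul0r expectation_cst.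
rewrite event_countS expectationD ?(Lfun_subset12 Pfin) ?Lfun_event_count//;
  last exact: Lfun_indic.
by rewrite expectation_indic// IH PA -EFinD mulrSr mulrDl mul1r.
Qed.

(** By additivity only the covariances of [\1_(A i)] with [\1_(A n)], [i < m], remain, and each is
    [p ^+ 2 - p * p]. Keeping [m] apart from [n] lets the induction run with [A n] fixed, while
    [m <= n] rules out [i = n]. *)
Lemma covariance_event_count m n : (m <= n)%N ->
  covariance P (event_count A m) \1_(A n) = 0%E.
Proof.
elim: m => [_|m IH mn].
  by rewrite /event_count big_ord0 covariance_cst_l.
rewrite event_countS covarianceDl ?Lfun_event_count ?Lfun_indic//.
rewrite IH ?(ltnW mn)// covariance_indic// PAI ?ltn_eqF// !PA add0e.
by rewrite -EFinM -EFinB subrr.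
Qed.

Lemma variance_event_count n :
  ('V_P[event_count A n] = (n%:R * (p - p ^+ 2))%:E)%E.
Proof.
elim: n => [|n IH].
  by rewrite /event_count big_ord0 mul0r variance_cst.
rewrite event_countS varianceD ?Lfun_event_count ?Lfun_indic//.
rewrite covariance_event_count// mule0 adde0 IH /variance covariance_indic//.
rewrite setIid !PA -EFinM -EFinB -EFinD; congr EFin.
by rewrite mulrSr mulrDl mul1r expr2.
Qed.

(** Chebyshev at distance half the mean: the variance is at most [n%:R * p], and dividing it by
    [(n%:R * p / 2) ^+ 2] gives the bound. *)
Lemma event_count_lower_tail n : (0 < n)%N -> 0 < p ->
  (P [set w | (event_count A n w <= n%:R * p / 2)%R] <= (4 / (n%:R * p))%:E)%E.
Proof.
move=> n0 p0.
have np0 : 0 < n%:R * p by rewrite mulr_gt0 ?ltr0n.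
pose N : {RV P >-> R} := HB.pack (event_count A n)
  (isMeasurableFun.Build _ _ _ _ _ (measurable_event_count n)).
have eps0 : 0 < n%:R * p / 2 by rewrite divr_gt0.
have := chebyshev N eps0.
rewrite [X in 'V_P[X]%E]/= [X in 'E_P[X]%E]/=.
rewrite variance_event_count expectation_event_count /= => cheb.
apply: (le_trans _ (le_trans cheb _)).
- apply: le_measure; rewrite ?inE.
  + have := measurable_event_count n measurableT
      (measurable_itv `]-oo, n%:R * p / 2]).
    by rewrite setTI; congr measurable; apply/seteqP; split=> w /=; rewrite in_itv.
  + have mD : measurable_fun setT (fun w => `|event_count A n w - n%:R * p|).
      apply: measurableT_comp => //; apply: measurable_funB => //.
      exact: measurable_event_count.
    have := mD measurableT _ (measurable_itv `[n%:R * p / 2, +oo[).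
    by rewrite setTI; congr measurable; apply/seteqP; split=> w /=; rewrite in_itv/= andbT.
  + by move=> w /= Nw; rewrite ler0_norm; lra.
- rewrite -EFinM lee_fin.
  have -> : 4 / (n%:R * p) = (n%:R * p / 2) ^- 2 * (n%:R * p).
    by field; rewrite gt_eqF//= gt_eqF// ltr0n.
  rewrite ler_pM2l ?invr_gt0 ?exprn_gt0// ler_wpM2l// gerBl.
  exact: sqr_ge0.
Qed.

End event_counting.

(** * The kernel at [x = 0], and the mass of a density near 0 *)

Section kernel_at_zero.
Set Implicit Arguments.
Unset Strict Implicit.
Context {R : realType}.
Notation mu := (@lebesgue_measure R).

(** For [a = 1] the integrand is the exponential density of rate 1; the endpoints by which the two
    intervals differ are null sets. *)
Lemma lower_incomplete_gamma1 (z : R) : 0 < z ->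
  lower_incomplete_gamma 1 z = 1 - expR (- z).
Proof.
move=> z0; rewrite /lower_incomplete_gamma /Rintegral.
have -> : (\int[mu]_(t in `]0%R, z[) (t `^ (1 - 1) * expR (- t))%:E =
           exponential_prob 1 `[0%R, z])%E.
  have mexp (D : set R) : measurable_fun D (fun x => (exponential_pdf (1:R) x)%:E).
    by apply/measurable_EFinP; apply: measurable_funTS; exact: measurable_exponential_pdf.
  rewrite /exponential_prob -integral_itv_bndo_bndc// -integral_itv_obnd_cbnd//.
  apply: eq_integral => t; rewrite inE/= in_itv/= => /andP[t0 _].
  by rewrite subrr powRr0 exponential_pdfE ?ltW// mul1r mulN1r mul1r.
by rewrite exponential_prob_itv0c// mulN1r.
Qed.

Lemma truncated_gamma_kernel0 (c b u : R) : 0 < c -> 0 < b ->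
  truncated_gamma_kernel c b 0 u =
  expR (- (u / b)) / (b * (1 - expR (- (c / b)))) * \1_(`[0, c[%classic) u.
Proof.
move=> c0 b0; rewrite /truncated_gamma_kernel mul0r add0r powRr0 mul1r.
by rewrite lower_incomplete_gamma1 ?divr_gt0// powRr1 ?ltW.
Qed.

(** On [[0, b[] the exponent [u / b] is at most 1, and the normalising factor [1 - expR (- (c / b))]
    is at most 1; [b <= c] keeps this interval inside the support of the kernel. Elsewhere
    nonnegativity suffices. *)
Lemma truncated_gamma_kernel0_ge (c b u : R) : 0 < b <= c ->
  expR (-1) / b * \1_(`[0, b[%classic) u <= truncated_gamma_kernel c b 0 u.
Proof.
move=> /andP[b0 bc]; have c0 := lt_le_trans b0 bc.
rewrite truncated_gamma_kernel0//.
have g0 : 0 < 1 - expR (- (c / b)) by rewrite subr_gt0 expR_lt1 oppr_lt0 divr_gt0.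
rewrite [\1_(`[0, b[%classic) u]indicE.
have [|_] := boolP (u \in _); last first.
  rewrite mulr0 !mulr_ge0 ?expR_ge0// invr_ge0 mulr_ge0 ?ltW//.
rewrite inE/= in_itv/= => /andP[u0 ub].
rewrite indicE mem_set/=; last by rewrite in_itv/= u0 (lt_le_trans ub).
rewrite !mulr1 ler_pM ?expR_ge0 ?invr_ge0 ?(ltW b0)//.
  by rewrite ler_expR lerN2 ler_pdivrMr// mul1r ltW.
by rewrite lef_pV2 ?posrE ?mulr_gt0// ler_piMr ?(ltW b0)// gerBl expR_ge0.
Qed.

Lemma measurable_truncated_gamma_kernel0 (c b : R) : 0 < c -> 0 < b ->
  measurable_fun setT (truncated_gamma_kernel c b 0).
Proof.
move=> c0 b0.
rewrite (_ : truncated_gamma_kernel c b 0 = fun u =>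
    expR (- (u / b)) / (b * (1 - expR (- (c / b)))) * \1_(`[0, c[%classic) u);
  last by apply/funext => u; rewrite truncated_gamma_kernel0.
apply: measurable_funM; last exact: measurable_indic.
apply: measurable_funM => //.
apply: measurableT_comp => //; apply: measurableT_comp => //.
exact: measurable_funM.
Qed.

Lemma le_integral_near0 (f : R -> R) (L b : R) :
  measurable_fun setT f -> (forall x, 0 <= f x) -> 0 <= L -> 0 < b ->
  (forall x, 0 < x < b -> L <= f x) ->
  ((L * b)%:E <= \int[mu]_(x in `[0%R, b[) (f x)%:E)%E.
Proof.
move=> mf f0 L0 b0 Lf.
have mfE (D : set R) : measurable_fun D (fun x => (f x)%:E).
  by apply/measurable_EFinP; exact: measurable_funTS.
(* The point 0 is dropped because a limit at [0^'+] says nothing about [f 0]. *)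
rewrite -integral_itv_obnd_cbnd//.
have -> : ((L * b)%:E = \int[mu]_(x in `]0%R, b[) L%:E)%E.
  rewrite integral_cst//= lebesgue_measure_itv/= lte_fin b0.
  by rewrite sube0.
by apply: ge0_le_integral => //=; exact: mfE.
Qed.

End kernel_at_zero.

(** * A tail bound for the estimator at 0, for fixed [n] and [b] *)

Section estimator_at_zero.
Set Implicit Arguments.
Unset Strict Implicit.
Context {R : realType} {d : measure_display} {T : measurableType d}.
Variable P : probability T R.

Lemma mutually_independentI (I : choiceType) (X : I -> {RV P >-> R}) (A : set R) (i j : I) :
  mutually_independent X -> measurable A -> i != j ->
  (P (X i @^-1` A `&` X j @^-1` A) = P (X i @^-1` A) * P (X j @^-1` A))%E.
Proof.
move=> hX mA ij; have := hX [fset i; j]%fset (fun=> A) (fun=> mA).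
rewrite big_fsetU1 ?inE//= big_seq_fset1 => <-; congr (P _).
apply/seteqP; split => [w [wi wj] k /=|w Xw].
  by rewrite !inE => /orP[] /eqP ->.
by split; apply: Xw; rewrite /= !inE eqxx ?orbT.
Qed.

Variables (X : nat -> {RV P >-> R}) (c : R).
Hypothesis c0 : 0 < c.

Let near0 (b : R) i := X i @^-1` `[0, b[%classic.

Lemma density_estimator0_ge (b : R) n w : 0 < b <= c ->
  expR (-1) / b * (n%:R^-1 * event_count (near0 b) n w) <=
  density_estimator c b n (X^~ w) 0.
Proof.
move=> bc; rewrite /density_estimator mulrCA ler_wpM2l ?invr_ge0//.
rewrite /event_count fct_sumE mulr_sumr ler_sum// => i _.
exact: truncated_gamma_kernel0_ge.
Qed.

Lemma measurable_density_estimator0 (b : R) n : 0 < b ->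
  measurable_fun setT (fun w => density_estimator c b n (X^~ w) 0).
Proof.
move=> b0; apply: measurable_funM => //; apply: measurable_sum => i.
apply: measurableT_comp => //; exact: measurable_truncated_gamma_kernel0.
Qed.

Lemma density_estimator0_tail (f : R -> R) (b L : R) n :
  is_pdf f -> iid_with_pdf X f -> (0 < n)%N -> 0 < b <= c -> 0 < L ->
  (forall x, 0 < x < b -> L <= f x) ->
  ((1 - 4 / (n%:R * (L * b)))%:E <=
   P [set w | (expR (-1) * L / 2 < density_estimator c b n (X^~ w) 0)%R])%E.
Proof.
move=> [mf f0 _] [hind hpdf] n0 /andP[b0 bc] L0 Lf.
have mI : measurable (`[0, b[%classic : set R) by exact: measurable_itv.
have mA i : measurable (near0 b i) by exact: measurable_funPTI.
pose p := fine (P (near0 b 0)).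
have PA i : P (near0 b i) = p%:E.
  by rewrite /p fineK ?fin_num_measure// [LHS](hpdf i _ mI) -(hpdf 0%N _ mI).
have PAI i j : i != j -> P (near0 b i `&` near0 b j) = (p ^+ 2)%:E.
  move=> ij; rewrite [LHS](mutually_independentI hind mI ij) expr2 EFinM.
  by congr (_ * _)%E; exact: PA.
have Lbp : L * b <= p.
  rewrite -lee_fin -(PA 0%N) [leRHS](hpdf 0%N _ mI).
  by apply: le_integral_near0 => //; exact: ltW.
have p0 : 0 < p by rewrite (lt_le_trans _ Lbp)// mulr_gt0.
have nr0 : 0 < n%:R :> R by rewrite ltr0n.
set E := [set w | _].
have mE : measurable E.
  have := measurable_density_estimator0 n b0 measurableT
    (measurable_itv `]expR (-1) * L / 2, +oo[).
  by rewrite setTI; congr measurable; apply/seteqP; split=> w /=; rewrite in_itv/= andbT.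
have mF : measurable [set w | (event_count (near0 b) n w <= n%:R * p / 2)%R].
  have := measurable_event_count P mA n measurableT
    (measurable_itv `]-oo, n%:R * p / 2]).
  by rewrite setTI; congr measurable; apply/seteqP; split=> w /=; rewrite in_itv.
(* It remains to bound the complement of [E], which is contained in the event that the count is at
   most half its mean. *)
rewrite -[E]setCK probability_setC; last exact: measurableC.
rewrite EFinB leeB//.
apply: (@le_trans _ _
    (P [set w | (event_count (near0 b) n w <= n%:R * p / 2)%R])).
  apply: le_measure; rewrite ?inE//; first exact: measurableC.
  move=> w /= /negP; rewrite -leNgt => Ew; rewrite leNgt; apply/negP => Fw.
  have := density_estimator0_ge n w (introT andP (conj b0 bc)).
  rewrite leNgt => /negP; apply; apply: (le_lt_trans Ew).
  (* After cancelling [expR (-1)] and clearing denominators, a count above [n%:R * p / 2] suffices,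
     since [L * b <= p]. *)
  rewrite -!mulrA ltr_pM2l ?expR_gt0//.
  rewrite ltr_pdivlMl// ltr_pdivlMl//.
  by apply: le_lt_trans Fw; rewrite -mulrA ler_pM2l// mulrA mulrC [b * L]mulrC mulrC ler_pM2r.
apply: (le_trans (event_count_lower_tail mA PA PAI n0 p0)).
by rewrite lee_fin ler_pM2l// lef_pV2 ?posrE ?mulr_gt0// ler_pM2l.
Qed.

End estimator_at_zero.

(** * Passage to the limit *)

Theorem theorem3 (R : realType) (d : measure_display) (T : measurableType d)
    (P : probability T R) (c : R) (hc : 0 < c)
    (f : R -> R) (hf : is_pdf f)
    (hsupp : forall x : R, x < 0 -> f x = 0)
    (hunb : f x @[x --> 0^'+] --> +oo)
    (X : nat -> {RV P >-> R}) (hX : iid_with_pdf X f)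
    (b : nat -> R) (hb : forall n, (0 < n)%N -> 0 < b n)
    (hb0 : b n + (n%:R * b n ^+ 2)^-1 @[n --> \oo] --> 0) :
  cvg_in_probability_pinfty P
    (fun n w => density_estimator c (b n) n (fun i => X i w) 0).
Proof.
(* [L] is chosen so that the threshold [expR (-1) * L / 2] of the tail bound is exactly [M]. *)
move=> M M0; pose L := 2 * expR 1 * M.
have L0 : 0 < L by rewrite !mulr_gt0 ?expR_gt0.
have ML : expR (-1) * L / 2 = M.
  by rewrite /L expRN; field; rewrite gt_eqF ?expR_gt0.
have [e /= e0 He] : \forall x \near 0^'+, L <= f x by move/cvgryPge : hunb; exact.
have s_ge0 n : (0 < n)%N -> 0 <= (n%:R * b n ^+ 2)^-1.
  by move=> n0; rewrite invr_ge0 mulr_ge0// exprn_ge0 ?ltW ?hb.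
(* Both terms of [hb0] are nonnegative once [n > 0], so each is squeezed between 0 and their sum. *)
have b_cvg : b n @[n --> \oo] --> 0.
  apply: (squeeze_cvgr _ (cvg_cst 0) hb0); near=> n.
  have n0 : (0 < n)%N by near: n; exact: nbhs_infty_gt.
  by rewrite ltW ?hb//= lerDl s_ge0.
have s_cvg : (n%:R * b n ^+ 2)^-1 @[n --> \oo] --> 0.
  apply: (squeeze_cvgr _ (cvg_cst 0) hb0); near=> n.
  have n0 : (0 < n)%N by near: n; exact: nbhs_infty_gt.
  by rewrite s_ge0//= lerDr ltW ?hb.
(* The error [4 / (n%:R * (L * b n))] is written as a constant times the product of the two
   vanishing terms of [hb0]. *)
have lower_cvg : (1 - 4 / L * (b n * (n%:R * b n ^+ 2)^-1))%:E @[n --> \oo] --> 1%E.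
  apply: cvg_EFin; first by near=> n.
  rewrite [X in _ --> X](_ : _ = 1 - 4 / L * (0 * 0)); last by rewrite !mulr0 subr0.
  apply: cvgB; first exact: cvg_cst.
  by apply: cvgM; [exact: cvg_cst|exact: cvgM].
apply: (squeeze_cvge _ lower_cvg (cvg_cst 1%E)); near=> n.
have n0 : (0 < n)%N by near: n; exact: nbhs_infty_gt.
have b0 := hb n n0.
have bc : b n <= c by near: n; apply: (cvgr_le 0).
have be : b n <= e by near: n; apply: (cvgr_le 0).
have Lf x : 0 < x < b n -> L <= f x.
  move=> /andP[x0 xb]; apply: He => //=.
  by rewrite sub0r normrN gtr0_norm// (lt_le_trans xb).
apply/andP; split; last first.
  apply: probability_le1.
  have := measurable_density_estimator0 X hc n b0 measurableT
    (measurable_itv `]M, +oo[).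
  by rewrite setTI; congr measurable; apply/seteqP; split=> w /=; rewrite in_itv/= andbT.
have := @density_estimator0_tail R d T P X c hc f (b n) L n hf hX n0 _ L0 Lf.
rewrite b0 bc ML => /(_ isT); apply: le_trans.
rewrite lee_fin lerD2l lerN2 le_eqVlt; apply/orP; left; apply/eqP.
by field; rewrite !gt_eqF ?ltr0n.
Unshelve. all: by end_near.
Qed.
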